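(* Let $c>0$, $\pi\in(0,1)$, and let $e^{\varepsilon_0(n)}=c^2n$ with $\varepsilon_0(n)>0$ (canonical calibration), so $\delta_n:=1/(1+e^{\varepsilon_0(n)})=(1+c^2n)^{-1}$, and $k=\lfloor\pi n\rfloor$. Let $P_n$ be the law of $A-B$ with $A\sim\mathrm{Bin}(n-k,\delta_n)$ and $B\sim\mathrm{Bin}(k,\delta_n)$ independent, and $Q_n$ the law of $1+A'-B'$ with $A'\sim\mathrm{Bin}(n-k-1,\delta_n)$ and $B'\sim\mathrm{Bin}(k+1,\delta_n)$ independent. Let $D=X-Y$ with $X\sim\mathrm{Poi}((1-\pi)/c^2)$ and $Y\sim\mathrm{Poi}(\pi/c^2)$ independent, and $(P_\infty,Q_\infty):=(\mathcal L(D),\mathcal L(1+D))$. Then $$\Delta\bigl((P_n,Q_n),(P_\infty,Q_\infty)\bigr)\le\frac{2c^2+3}{c^4n}.$$ In particular, the Skellam limit is attained at the explicit rate $O(n^{-1})$.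
   Context: $\mathrm{TV}(\mu,\nu):=\sup_A|\mu(A)-\nu(A)|$. For binary experiments (ordered pairs of probability measures) $(P,Q)$ and $(P',Q')$, the deficiency of the first relative to the second is $\inf_K\max\{\mathrm{TV}(PK,P'),\mathrm{TV}(QK,Q')\}$ over Markov kernels $K$; the Le Cam distance $\Delta$ is the maximum of the two deficiencies. $P_n$ and $Q_n$ are the laws of (number of output ones) $-k$ for shuffled binary randomized response with flip probability $\delta_n$ on datasets with $k$ and $k+1$ ones, respectively. *)

(* Defs.v *)
From HB Require Import structures.
From mathcomp Require Import all_boot all_order all_algebra.
From mathcomp Require Import archimedean.
From mathcomp Require Import all_classical all_reals all_analysis.

Set Implicit Arguments.
Unset Strict Implicit.
Unset Printing Implicit Defensive.
Import Order.TTheory GRing.Theory Num.Theory.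
Import numFieldNormedType.Exports.

Local Open Scope classical_set_scope.
Local Open Scope ring_scope.

HB.instance Definition _ := isPointed.Build int 0.
HB.instance Definition _ := @isMeasurable.Build default_measure_display
  int discrete_measurable discrete_measurable0
  discrete_measurableC discrete_measurableU.

(* In [tv] and [deficiency], the sup and inf are taken in [R]: for probability
   measures and probability kernels the values lie in [0, 1] and the index sets
   are nonempty (constant kernels exist), so no default value is involved. *)

Definition tv {d : measure_display} {T : measurableType d} {R : realType}
    (mu nu : set T -> \bar R) : R :=
  sup [set `|fine (mu A) - fine (nu A)| | A in [set A | measurable A]].

Definition kernel_image {d d' : measure_display} {T : measurableType d}
    {T' : measurableType d'} {R : realType}
    (P : probability T R) (K : R.-pker T ~> T') : set T' -> \bar R :=
  fun A => (\int[P]_x K x A)%E.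

Definition experiment {d : measure_display} (T : measurableType d)
    (R : realType) : Type := (probability T R * probability T R)%type.

Definition deficiency {d d' : measure_display} {T : measurableType d}
    {T' : measurableType d'} {R : realType}
    (E : experiment T R) (E' : experiment T' R) : R :=
  inf [set Num.max (tv (kernel_image E.1 K) E'.1) (tv (kernel_image E.2 K) E'.2)
      | K in [set: R.-pker T ~> T']].

Definition le_cam_distance {d d' : measure_display} {T : measurableType d}
    {T' : measurableType d'} {R : realType}
    (E : experiment T R) (E' : experiment T' R) : R :=
  Num.max (deficiency E E') (deficiency E' E).

Definition diffz (ab : nat * nat) : int := ab.1%:Z - ab.2%:Z.

Definition succ_diffz (ab : nat * nat) : int := 1 + (ab.1%:Z - ab.2%:Z).

Lemma measurable_natnat (A : set (nat * nat)) : measurable A.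
Proof.
apply: countable_measurable => [[a b]|]; last exact: countableP.
rewrite (_ : [set (a, b)] = [set a] `*` [set b]); first exact: measurableX.
by apply/seteqP; split => [_ ->|[x y] [/= -> ->]].
Qed.

Lemma measurable_fun_natnat (f : nat * nat -> int) : measurable_fun setT f.
Proof. by move=> _ Y _; exact: measurable_natnat. Qed.

HB.instance Definition _ := isMeasurableFun.Build _ _ _ _ diffz
  (measurable_fun_natnat diffz).
HB.instance Definition _ := isMeasurableFun.Build _ _ _ _ succ_diffz
  (measurable_fun_natnat succ_diffz).

(* Laws of [A - B] and of [1 + A - B] for independent [A ~ mu] and [B ~ nu]. *)
Definition law_diff {R : realType} (mu nu : probability nat R) :
    probability int R :=
  distribution (mu \x nu)%E diffz.

Definition law_succ_diff {R : realType} (mu nu : probability nat R) :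
    probability int R :=
  distribution (mu \x nu)%E succ_diffz.

Definition flip_prob {R : realType} (eps0 : R) : R := 1 / (1 + expR eps0).

(* The centred number of output ones under shuffled randomized response on
   datasets of size [n] with [k], respectively [k + 1], ones; it needs [k < n],
   otherwise the subtractions on nat truncate. *)
Definition shuffled_rr {R : realType} (n k : nat) (delta : R) :
    experiment int R :=
  (law_diff (binomial_prob (n - k)%N delta) (binomial_prob k delta),
   law_succ_diff (binomial_prob (n - k - 1)%N delta)
                 (binomial_prob k.+1 delta)).

(* [poisson_prob] takes a spurious nat argument, which it ignores. *)
Definition skellam_shift {R : realType} (lambda mu : R) : experiment int R :=
  (law_diff (poisson_prob lambda 0%N) (poisson_prob mu 0%N),
   law_succ_diff (poisson_prob lambda 0%N) (poisson_prob mu 0%N)).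

(* Main.v *)
(** The identity kernel bounds the Le Cam distance by the larger of the two
total variation distances, and the total variation distance of two laws of
[A - B] by the sum of those of the two factors. Writing [F A x] for the
Poisson probability of [A] at rate [x], one has [F' A = F (A - 1) - F A]; the
mean value theorem gives [|F A x - F A y| <= |x - y|] and a first-order Taylor
remainder of at most [2 d^2]. Conditioning on one trial,
[Bin(m+1,d) A = (1-d) Bin(m,d) A + d Bin(m,d) (A - 1)], so that [Bin(m,d)] is
within [2 m d^2] of [Poi(m d)]. The two binomials together cost
[2 n d^2 <= 2 / (c^4 n)], rounding [k] costs [2 d <= 2 / (c^2 n)], and replacing
[n d] by [1 / c^2] costs [d / c^2 <= 1 / (c^4 n)]. *)

Require Import Defs.
From HB Require Import structures.
From mathcomp Require Import all_boot all_order all_algebra.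
From mathcomp Require Import archimedean.
From mathcomp Require Import all_classical all_reals all_analysis.
From mathcomp Require Import ring lra.

Set Implicit Arguments.
Unset Strict Implicit.
Unset Printing Implicit Defensive.
Import Order.TTheory GRing.Theory Num.Theory.
Import numFieldNormedType.Exports.

Local Open Scope classical_set_scope.
Local Open Scope ring_scope.

(** * Poisson probabilities as functions of the rate *)

Definition fact_coeff {R : realType} (A : set nat) (k : nat) : R :=
  \1_A k * (k`!%:R)^-1.

(** The Poisson probability of [A], as a power series defined for every real rate so that it can be
    differentiated at 0 too. *)
Definition poisson_fun {R : realType} (A : set nat) (x : R) : R :=
  expR (- x) * limn (pseries (fact_coeff A) x).

Section poisson_fun.
Context {R : realType}.
Implicit Types (A : set nat) (x y d : R).

Lemma is_cvg_pseries_fact_coeff A x : cvgn (pseries (fact_coeff A) x).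
Proof.
(* Domination by the exponential series at a point beyond [|x|]. *)
have H : cvgn (pseries (fact_coeff A) (`|x| + 1)).
  have x0 : 0 <= `|x| + 1 by rewrite addr_ge0.
  apply: (series_le_cvg _ _ _ (is_cvg_series_exp_coeff (`|x| + 1))) => n.
  - by rewrite /fact_coeff !mulr_ge0// ?exprn_ge0// indicE ler0n.
  - exact: exp_coeff_ge0.
  - rewrite /fact_coeff /exp_coeff/= mulrC ler_wpM2l ?exprn_ge0//.
    by rewrite ler_piMl// indicE; case: (_ \in _).
apply: (is_cvg_pseries_inside H).
by rewrite [ltRHS]ger0_norm ?addr_ge0// ltrDl.
Qed.

(** Since [(k + 1) / (k + 1)! = 1 / k!], termwise differentiation only shifts [A]. *)
Lemma pseries_diffs_fact_coeff A :
  pseries_diffs (@fact_coeff R A) = fact_coeff (S @^-1` A).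
Proof.
apply/funext => k; rewrite /pseries_diffs /fact_coeff factS natrM invfM.
by rewrite mulrCA mulVKf.
Qed.

Lemma is_derive_poisson_fun A x :
  is_derive x 1 (poisson_fun A) (poisson_fun (S @^-1` A) x - poisson_fun A x).
Proof.
have H : is_derive x (1 : R) (fun x => limn (pseries (fact_coeff A) x))
    (limn (pseries (fact_coeff (S @^-1` A)) x)).
  rewrite -pseries_diffs_fact_coeff.
  apply: (@pseries_snd_diffs _ _ (`|x| + 1));
    rewrite ?pseries_diffs_fact_coeff; try exact: is_cvg_pseries_fact_coeff.
  by rewrite [ltRHS]ger0_norm ?addr_ge0// ltrDl.
rewrite /poisson_fun.
apply: is_derive_eq.
by rewrite /GRing.scale/=; ring.
Qed.

Lemma continuous_poisson_fun A : continuous (@poisson_fun R A).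
Proof.
move=> x; apply: differentiable_continuous.
by apply/derivable1_diffP; have [] := is_derive_poisson_fun A x.
Qed.

Lemma poisson_probE x j A : 0 <= x -> poisson_prob x j A = (poisson_fun A x)%:E.
Proof.
move=> x0; rewrite /poisson_prob /poisson_fun; case: ifPn => [xgt0|]; last first.
  (* At rate 0 [poisson_prob] is by convention the Dirac mass at 0, and only the constant term of
     the series survives. *)
  rewrite lt_neqAle x0 andbT negbK => /eqP <-.
  rewrite oppr0 expR0 mul1r diracE; congr (_%:E).
  rewrite -[RHS]/(limn _); apply/esym/cvg_lim => //.
  rewrite -(cvg_shiftS _); apply: cvg_near_cst; near=> n.
  rewrite /pseries/= /series/= big_nat_recl//= big1 => [|i _].
    by rewrite expr0 /fact_coeff fact0 invr1 !mulr1 addr0 indicE.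
  by rewrite exprS mul0r mulr0.
rewrite esum_mkcond -nneseries_esumT; last first.
  by move=> n; case: ifPn; rewrite ?lee_fin ?poisson_pmf_ge0.
have -> : (expR (- x) * limn (pseries (fact_coeff A) x))%:E =
    ((expR (- x))%:E * \sum_(i <oo) (fact_coeff A i * x ^+ i)%:E)%E.
  rewrite EFinM; congr (_ * _)%E.
  rewrite -(EFin_lim (@is_cvg_pseries_fact_coeff A x)).
  by apply/congr_lim/funext => n/=; rewrite /pseries/series/= sumEFin.
rewrite -nneseriesZl => [|i _]; last first.
  by rewrite lee_fin /fact_coeff !mulr_ge0// ?exprn_ge0// indicE ler0n.
apply: eq_eseriesr => i _; rewrite -EFinM /fact_coeff /poisson_pmf xgt0 indicE.
by case: ifP => _; congr (_%:E); rewrite /=; ring.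
Unshelve. all: by end_near. Qed.

End poisson_fun.

(** * Lipschitz and Taylor bounds in the rate *)

Section poisson_fun_lipschitz.
Context {R : realType}.
Implicit Types (A : set nat) (x y d : R).

Lemma poisson_fun_ge0 A x : 0 <= x -> 0 <= poisson_fun A x.
Proof. by move=> x0; rewrite -lee_fin -(poisson_probE 0%N A x0). Qed.

Lemma poisson_fun_le1 A x : 0 <= x -> poisson_fun A x <= 1.
Proof.
by move=> x0; rewrite -lee_fin -(poisson_probE 0%N A x0) probability_le1.
Qed.

Lemma poisson_fun_MVT A x y : x <= y ->
  exists2 z, x <= z <= y & poisson_fun A y - poisson_fun A x =
    (poisson_fun (S @^-1` A) z - poisson_fun A z) * (y - x).
Proof.
move=> xy; have [z] := MVT_segment xy
  (fun z _ => is_derive_poisson_fun A z)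
  (continuous_subspaceT (@continuous_poisson_fun R A)).
by rewrite in_itv => xzy ->; exists z.
Qed.

(** The slope is a difference of two numbers in [[0, 1]]. *)
Lemma poisson_fun_lipschitz A x y : 0 <= x -> 0 <= y ->
  `|poisson_fun A x - poisson_fun A y| <= `|x - y|.
Proof.
wlog xy : x y / x <= y => [H x0 y0|x0 _].
  have [xy|/ltW yx] := leP x y; first exact: H.
  by rewrite distrC (distrC x); exact: H.
rewrite distrC (distrC x); have [z /andP[xz _] ->] := poisson_fun_MVT A xy.
have z0 := le_trans x0 xz.
rewrite normrM ler_piMl// ler_norml.
have := poisson_fun_ge0 A z0; have := poisson_fun_le1 A z0.
have := poisson_fun_ge0 (S @^-1` A) z0; have := poisson_fun_le1 (S @^-1` A) z0.
lra.
Qed.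

(** The increment is [d] times the derivative at an intermediate [z]; moving [z] back to [x] changes
    each of its two terms by at most [d]. *)
Lemma poisson_fun_taylor1 A x d : 0 <= x -> 0 <= d ->
  `|poisson_fun A (x + d) -
    ((1 - d) * poisson_fun A x + d * poisson_fun (S @^-1` A) x)|
  <= 2 * d ^+ 2.
Proof.
move=> x0 d0; have xd : x <= x + d by rewrite lerDl.
have [z /andP[xz zxd] E] := poisson_fun_MVT A xd.
have z0 := le_trans x0 xz.
have H B : `|poisson_fun B z - poisson_fun B x| <= d.
  apply: (le_trans (poisson_fun_lipschitz B z0 x0)).
  by rewrite ger0_norm; lra.
have -> : poisson_fun A (x + d) -
    ((1 - d) * poisson_fun A x + d * poisson_fun (S @^-1` A) x) =
    d * ((poisson_fun (S @^-1` A) z - poisson_fun (S @^-1` A) x) -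
         (poisson_fun A z - poisson_fun A x)).
  by move/eqP: E; rewrite subr_eq => /eqP ->; ring.
rewrite normrM ger0_norm// expr2 mulrCA ler_wpM2l//.
apply: (le_trans (ler_normB _ _)).
by have := H A; have := H (S @^-1` A); lra.
Qed.

End poisson_fun_lipschitz.

(** * Poisson approximation of the binomial law *)

Section binomial_poisson.
Context {R : realType}.
Implicit Types (A : set nat) (d : R) (m : nat).

Lemma binomial_prob_indic m d A : 0 <= d <= 1 ->
  binomial_prob m d A = (\sum_(k < m.+1) binomial_pmf m d k * \1_A k)%:E.
Proof.
move=> /andP[d0 d1]; rewrite (@binomial_probE _ m d d0 d1) -sumEFin.
by apply: eq_bigr => k _; rewrite EFinM indicE diracE.
Qed.

Lemma binomial_pmf_recr m d k :
  binomial_pmf m.+1 d k.+1 =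
  (1 - d) * binomial_pmf m d k.+1 + d * binomial_pmf m d k.
Proof.
rewrite /binomial_pmf binS subSS /unstable.onem mulrnDr; congr (_ + _).
  (* For [m <= k] the exponent [m - k.+1] truncates, but its binomial coefficient is 0. *)
  have [mk|km] := leqP m k; first by rewrite bin_small ?ltnS// !mulr0n mulr0.
  by rewrite -[in LHS](subnSK km) -[LHS]mulr_natr -[in RHS]mulr_natr !exprS; ring.
by rewrite exprS -[LHS]mulr_natr -[in RHS]mulr_natr; ring.
Qed.

Lemma binomial_probS m d A : 0 <= d <= 1 ->
  fine (binomial_prob m.+1 d A) = (1 - d) * fine (binomial_prob m d A) +
    d * fine (binomial_prob m d (S @^-1` A)).
Proof.
move=> d01; rewrite !binomial_prob_indic//= big_ord_recl/=.
(* Adding the vanishing term of index [m.+1] lets both sums be matched termwise. *)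
rewrite [X in (1 - d) * X](_ : _ = \sum_(k < m.+2) binomial_pmf m d k * \1_A k).
  rewrite [in RHS]big_ord_recl/= mulrDr -addrA; congr (_ + _).
    by rewrite /binomial_pmf !subn0 !bin0 !expr0 exprS /unstable.onem; ring.
  rewrite !mulr_sumr -big_split/=; apply: eq_bigr => i _.
  by rewrite binomial_pmf_recr/= !indicE /bump/= add1n; ring.
rewrite [RHS]big_ord_recr/= [X in X * _](_ : _ = 0) ?mul0r ?addr0//.
by rewrite /binomial_pmf bin_small// mulr0n.
Qed.

(* Each step of the recursion on [m] costs the second-order remainder of
   [poisson_fun_taylor1]. *)
Lemma binomial_poisson_le m d A : 0 <= d <= 1 ->
  `|fine (binomial_prob m d A) - poisson_fun A (m%:R * d)| <=
  m%:R * (2 * d ^+ 2).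
Proof.
move=> d01; have /andP[d0 d1] := d01.
elim: m A => [|m ih] A.
  rewrite !mul0r -[poisson_fun _ _]/(fine (poisson_fun A 0)%:E).
  rewrite -(poisson_probE 0%N A (lexx _)).
  rewrite binomial_prob_indic// big_ord1 /binomial_pmf /poisson_prob ltxx.
  by rewrite diracE indicE !expr0 bin0 !mul1r ?mulr1n subrr normr0.
rewrite binomial_probS// -natr1 [(_ + 1) * d]mulrDl.
rewrite [(_ + 1) * (2 * _)]mulrDl !mul1r.
have md : 0 <= m%:R * d by rewrite mulr_ge0.
have := poisson_fun_taylor1 A md d0.
move: (ih A) (ih (S @^-1` A)); move: (m%:R * d) md => x x0.
move: (m%:R * (2 * d ^+ 2)) (2 * d ^+ 2) => e t.
set a := fine _; set b := fine _; set u := poisson_fun _ _.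
set v := poisson_fun _ _; set w := poisson_fun _ _ => au bv H.
(* The two inductive errors enter as a convex combination, hence do not grow. *)
have -> : (1 - d) * a + d * b - w =
    (1 - d) * (a - u) + d * (b - v) - (w - ((1 - d) * u + d * v)) by ring.
apply: (le_trans (ler_normB _ _)); apply: lerD => //.
apply: (le_trans (ler_normD _ _)); rewrite !normrM (ger0_norm d0).
have d1' : 0 <= 1 - d by rewrite subr_ge0.
rewrite (ger0_norm d1').
have := ler_wpM2l d1' au; have := ler_wpM2l d0 bv; lra.
Qed.

(** Compare first with the Poisson law of the same mean [m d], then change the rate. *)
Lemma binomial_poisson_close m d x j A : 0 <= d <= 1 -> 0 <= x ->
  `|fine (binomial_prob m d A) - fine (poisson_prob x j A)| <=
  m%:R * (2 * d ^+ 2) + `|m%:R * d - x|.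
Proof.
move=> d01 x0; rewrite poisson_probE//=.
apply: (le_trans (ler_distD (poisson_fun A (m%:R * d)) _ _)).
apply: lerD; first exact: binomial_poisson_le.
by apply: poisson_fun_lipschitz => //; case/andP : d01 => *; rewrite mulr_ge0.
Qed.

End binomial_poisson.

(** * Perturbation of product measures *)

Section product_close.
Context d1 d2 (T1 : measurableType d1) (T2 : measurableType d2) {R : realType}.
Implicit Types (P : probability T1 R) (Q : probability T2 R).

Lemma product_probability_le P Q Q' (e : R) (E : set (T1 * T2)) :
  measurable E -> 0 <= e ->
  (forall B, measurable B -> fine (Q B) <= fine (Q' B) + e) ->
  fine ((P \x Q)%E E) <= fine ((P \x Q')%E E) + e.
Proof.
move=> mE e0 QQ'.
have finPQ (Q0 : probability T2 R) : (P \x Q0)%E E \is a fin_num.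
  exact: (fin_num_measure ((P \x Q0)%E : probability _ R)).
rewrite -lee_fin EFinD !fineK//.
(* As [P] has mass 1, [e] can be put under the integral and the sections compared pointwise. *)
have -> : ((P \x Q')%E E + e%:E =
    \int[P]_x (Q' (xsection E x) + e%:E))%E.
  rewrite ge0_integralD//=; last exact: measurable_fun_xsection.
  by rewrite integral_cst//= probability_setT mule1.
apply: ge0_le_integral => //=.
- exact: measurable_fun_xsection.
- by apply: emeasurable_funD => //; exact: measurable_fun_xsection.
- move=> x _; have mx : measurable (xsection E x) by exact: measurable_xsection.
  by rewrite -[leLHS]fineK ?fin_num_measure// -[X in (X + _)%E]fineK
    ?fin_num_measure// -EFinD lee_fin QQ'.
Qed.

End product_close.

Section product_close_swap.
Context d1 d2 (T1 : measurableType d1) (T2 : measurableType d2) {R : realType}.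
Implicit Types (P : probability T1 R) (Q : probability T2 R).

Lemma product_probability_swap P Q (E : set (T1 * T2)) : measurable E ->
  (P \x Q)%E E = (Q \x P)%E (unstable.swap @^-1` E).
Proof.
move=> mE; rewrite (@product_measure_unique _ _ _ _ _ P Q (P \x^ Q)%E)//.
by move=> A B mA mB; exact: product_measure2E.
Qed.

Lemma product_probability_close P P' Q Q' (a b : R) (E : set (T1 * T2)) :
  measurable E ->
  (forall B, measurable B -> `|fine (P B) - fine (P' B)| <= a) ->
  (forall B, measurable B -> `|fine (Q B) - fine (Q' B)| <= b) ->
  `|fine ((P \x Q)%E E) - fine ((P' \x Q')%E E)| <= a + b.
Proof.
move=> mE PP' QQ'.
have a0 : 0 <= a by apply: le_trans (PP' set0 measurable0).
have b0 : 0 <= b by apply: le_trans (QQ' set0 measurable0).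
have mE' : measurable (unstable.swap @^-1` E : set (T2 * T1)).
  by rewrite -[X in measurable X]setTI; exact: measurable_swap.
(* The factors are replaced one at a time, through [P \x Q']; the first one after swapping
   coordinates. *)
have := product_probability_le P mE b0 (Q := Q) (Q' := Q').
have := product_probability_le P mE b0 (Q := Q') (Q' := Q).
have := product_probability_le Q' mE' a0 (Q := P) (Q' := P').
have := product_probability_le Q' mE' a0 (Q := P') (Q' := P).
rewrite -!product_probability_swap// => H1 H2 H3 H4.
have {}H1 : fine ((P' \x Q')%E E) <= fine ((P \x Q')%E E) + a.
  by apply: H1 => B mB; have := PP' B mB; rewrite ler_norml; lra.
have {}H2 : fine ((P \x Q')%E E) <= fine ((P' \x Q')%E E) + a.
  by apply: H2 => B mB; have := PP' B mB; rewrite ler_norml; lra.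
have {}H3 : fine ((P \x Q')%E E) <= fine ((P \x Q)%E E) + b.
  by apply: H3 => B mB; have := QQ' B mB; rewrite ler_norml; lra.
have {}H4 : fine ((P \x Q)%E E) <= fine ((P \x Q')%E E) + b.
  by apply: H4 => B mB; have := QQ' B mB; rewrite ler_norml; lra.
by rewrite ler_norml; lra.
Qed.

End product_close_swap.

(** * Total variation, deficiency and Le Cam distance *)

Section total_variation.
Context d (T : measurableType d) {R : realType}.
Implicit Types mu nu : set T -> \bar R.

Lemma tv_ge0 mu nu : 0 <= tv mu nu.
Proof.
rewrite /tv; set D := (X in sup X).
(* A set without supremum has [sup] equal to 0 by default. *)
have [[[x Dx] Dub]|/sup_out ->//] := pselect (has_sup D).
by apply: le_trans (ub_le_sup Dub Dx); case: Dx => A _ <-.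
Qed.

Lemma tv_le mu nu (e : R) :
  (forall A, measurable A -> `|fine (mu A) - fine (nu A)| <= e) ->
  tv mu nu <= e.
Proof.
move=> H; apply: ge_sup => [|_ [A mA <-]]; last exact: H.
by exists `|fine (mu set0) - fine (nu set0)|, set0; first exact: measurable0.
Qed.

Lemma tvC mu nu : tv mu nu = tv nu mu.
Proof.
by rewrite /tv; congr sup; apply/seteqP; split => _ [A mA <-]; exists A;
  rewrite //= distrC.
Qed.

End total_variation.

Section deficiency.
Context {R : realType}.

Lemma deficiency_ge0 d d' (T : measurableType d) (T' : measurableType d')
  (E : experiment T R) (E' : experiment T' R) : 0 <= deficiency E E'.
Proof.
rewrite /deficiency; set D := (X in inf X).
have [->|D0] := eqVneq D set0; first by rewrite inf0.
apply: lb_le_inf; first exact/set0P.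
by move=> _ [K _ <-]; rewrite le_max tv_ge0.
Qed.

Lemma deficiency_le_tv d (T : measurableType d) (E E' : experiment T R) :
  deficiency E E' <= Num.max (tv E.1 E'.1) (tv E.2 E'.2).
Proof.
(* The Dirac kernel acts as the identity on [P]. *)
have dirac_image (P : probability T R) :
    tv (kernel_image P (kdirac (@measurable_id _ T setT))) = tv P.
  apply/funext => nu; rewrite /tv; congr sup.
  apply: eq_imagel => A mA; congr `|fine _ - _|.
  by rewrite -[RHS]/(P A) -[X in _ = P X]setIT -integral_indic.
rewrite -!dirac_image; apply: ge_inf.
  by exists 0 => _ [K _ <-]; rewrite le_max tv_ge0.
by eexists.
Qed.

Lemma le_cam_distance_ge0 d d' (T : measurableType d) (T' : measurableType d')
  (E : experiment T R) (E' : experiment T' R) : 0 <= le_cam_distance E E'.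
Proof. by rewrite le_max deficiency_ge0. Qed.

Lemma le_cam_distance_le_tv d (T : measurableType d) (E E' : experiment T R) :
  le_cam_distance E E' <= Num.max (tv E.1 E'.1) (tv E.2 E'.2).
Proof.
by rewrite ge_max deficiency_le_tv/= [in leRHS]tvC [X in Num.max _ X]tvC
  deficiency_le_tv.
Qed.

End deficiency.

(** * The explicit rate *)

Section rate.
Context {R : realType}.

Lemma tv_law_diff_le (mu mu' nu nu' : probability nat R) (a b : R) :
  (forall A, `|fine (mu A) - fine (mu' A)| <= a) ->
  (forall A, `|fine (nu A) - fine (nu' A)| <= b) ->
  tv (law_diff mu nu) (law_diff mu' nu') <= a + b /\
  tv (law_succ_diff mu nu) (law_succ_diff mu' nu') <= a + b.
Proof.
move=> Ha Hb; split; apply: tv_le => A mA;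
  exact: product_probability_close (measurable_natnat _)
    (fun B _ => Ha B) (fun B _ => Hb B).
Qed.

(** Here [s] is [c^2], and [N], [K] are the trial numbers of the two binomials; the tolerance 1 on
    [K - p * n] covers both [k] and [k + 1]. *)
Lemma canonical_rate (s p d N K n : R) : 0 < s -> 0 <= p <= 1 -> 0 < n ->
  N + K = n -> `|K - p * n| <= 1 -> d = (1 + s * n)^-1 ->
  (N * (2 * d ^+ 2) + `|N * d - (1 - p) / s|) +
  (K * (2 * d ^+ 2) + `|K * d - p / s|) <= (2 * s + 3) / (s ^+ 2 * n).
Proof.
move=> s0 /andP[p0 p1] n0 NK Kpn dE.
have sn0 : 0 < s * n by rewrite mulr_gt0.
have d0 : 0 < d by rewrite dE invr_gt0; lra.
have sd0 : 0 < d / s by rewrite divr_gt0.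
have nd : n * d = s^-1 - d / s.
  by rewrite dE; field; rewrite !gt_eqF//; lra.
(* Rounding costs [d], and replacing [n d] by [1 / s] costs the share [q] of [d / s]; the shares [p]
   and [1 - p] add up to 1. *)
have dev (q x : R) : 0 <= q -> `|x - q * n| <= 1 ->
    `|x * d - q / s| <= d + q * (d / s).
  move=> q0 xq.
  have -> : x * d - q / s = d * (x - q * n) - q * (d / s).
    by rewrite mulrBr (mulrCA d q) (mulrC d n) nd; ring.
  apply: (le_trans (ler_normB _ _)); rewrite (normrM d) (normrM q).
  rewrite (ger0_norm q0) (gtr0_norm sd0) (gtr0_norm d0).
  by rewrite lerD2r ler_piMr// ltW.
have HK := dev p K p0 Kpn.
have HN : `|N * d - (1 - p) / s| <= d + (1 - p) * (d / s).
  apply: dev; first lra.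
  by rewrite (_ : N - _ = - (K - p * n)) ?normrN// -NK; ring.
(* With [d <= t] the target splits as [2 t] for rounding twice, [2 t / s] for the binomials and
   [t / s] for the rates. *)
pose t := (s * n)^-1.
have dt : d <= t by rewrite dE lef_pV2 ?posrE//; lra.
have nt : n * t = s^-1 by rewrite /t invfM mulrCA divff ?mulr1// gt_eqF.
have -> : (2 * s + 3) / (s ^+ 2 * n) = 2 * t + 3 * (t / s).
  by rewrite /t; field; rewrite !gt_eqF.
have nd2 : n * (2 * d ^+ 2) <= 2 * (t / s).
  have -> : 2 * (t / s) = n * (2 * t ^+ 2).
    by rewrite -nt; ring.
  by rewrite ler_pM2l// ler_pM2l// ler_sqr ?nnegrE; lra.
have ds : d / s <= t / s by rewrite ler_pM2r ?invr_gt0.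
have NK2 : N * (2 * d ^+ 2) + K * (2 * d ^+ 2) = n * (2 * d ^+ 2).
  by rewrite -mulrDl NK.
lra.
Qed.

Lemma le_cam_shuffled_rr_le (s p d : R) (n k : nat) : 0 < s ->
  0 < p -> p < 1 -> (0 < n)%N -> k = Num.truncn (p * n%:R) ->
  d = (1 + s * n%:R)^-1 ->
  le_cam_distance (shuffled_rr n k d) (skellam_shift ((1 - p) / s) (p / s))
  <= (2 * s + 3) / (s ^+ 2 * n%:R).
Proof.
move=> s0 p0 p1 n0 kE dE.
have nR0 : 0 < n%:R :> R by rewrite ltr0n.
have sn0 : 0 < s * n%:R by rewrite mulr_gt0.
have d01 : 0 <= d <= 1.
  by rewrite dE invr_ge0 invf_le1; lra.
have /andP[kp pk] : k%:R <= p * n%:R < k.+1%:R.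
  by rewrite kE truncn_itv// mulr_ge0// ltW.
(* Since [p < 1], neither [n - k] nor [n - k - 1] truncates. *)
have kn : (k < n)%N.
  by rewrite -(ltr_nat R) (le_lt_trans kp)// gtr_pMl.
have ps0 : 0 <= p / s by rewrite divr_ge0// ltW.
have qs0 : 0 <= (1 - p) / s by rewrite divr_ge0 ?subr_ge0// ltW.
have p01 : 0 <= p <= 1 by rewrite !ltW.
have rate N K : (N + K)%N = n -> `|K%:R - p * n%:R| <= 1 ->
    (N%:R * (2 * d ^+ 2) + `|N%:R * d - (1 - p) / s|) +
    (K%:R * (2 * d ^+ 2) + `|K%:R * d - p / s|)
    <= (2 * s + 3) / (s ^+ 2 * n%:R).
  by move=> NK Kp; apply: (canonical_rate s0 p01) => //; rewrite -natrD NK.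
apply: (le_trans (le_cam_distance_le_tv _ _)); rewrite ge_max.
have close N K := @tv_law_diff_le _ _ _ _ _ _
  (fun A => binomial_poisson_close N 0%N A d01 qs0)
  (fun A => binomial_poisson_close K 0%N A d01 ps0).
(* The deviation from [p n] lies in [(-1, 0]] for [k] ones and in [(0, 1]] for [k + 1]. *)
apply/andP; split.
- apply: (le_trans (close _ _).1); apply: rate.
    by rewrite subnK// ltnW.
  by rewrite ler_norml; move: pk; rewrite -natr1; lra.
- apply: (le_trans (close _ _).2); apply: rate.
    by rewrite -subnDA addn1 subnK.
  by rewrite ler_norml -natr1; move: pk; rewrite -natr1; lra.
Qed.

End rate.

Theorem corollary4p2 (R : realType) (c p : R) (eps0 : nat -> R)
    (hc : 0 < c) (hp0 : 0 < p) (hp1 : p < 1) :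
  let delta (n : nat) : R := flip_prob (eps0 n) in
  let k (n : nat) : nat := Num.truncn (p * n%:R) in
  let Delta (n : nat) : R :=
    le_cam_distance (shuffled_rr n (k n) (delta n))
                    (skellam_shift ((1 - p) / c ^+ 2) (p / c ^+ 2)) in
  (forall n : nat, 0 < eps0 n -> expR (eps0 n) = c ^+ 2 * n%:R ->
     delta n = (1 + c ^+ 2 * n%:R)^-1 /\
     Delta n <= (2%:R * c ^+ 2 + 3%:R) / (c ^+ 4 * n%:R)) /\
  ((\forall n \near \oo, 0 < eps0 n /\ expR (eps0 n) = c ^+ 2 * n%:R) ->
     Delta =O_\oo (fun n : nat => (n%:R : R)^-1)).
Proof.
move=> delta k Delta.
have c2 : 0 < c ^+ 2 by rewrite exprn_gt0.
have bound n : 0 < eps0 n -> expR (eps0 n) = c ^+ 2 * n%:R ->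
    delta n = (1 + c ^+ 2 * n%:R)^-1 /\
    Delta n <= (2%:R * c ^+ 2 + 3%:R) / (c ^+ 4 * n%:R).
  move=> eps_gt0 epsE.
  have deltaE : delta n = (1 + c ^+ 2 * n%:R)^-1.
    by rewrite /delta /flip_prob epsE div1r.
  split=> //; rewrite (_ : c ^+ 4 = (c ^+ 2) ^+ 2); last by rewrite -exprM.
  apply: le_cam_shuffled_rr_le => //.
  (* The calibration itself excludes [n = 0], as an exponential is positive. *)
  have := expR_gt0 (eps0 n); rewrite epsE.
  by case: n {eps_gt0 epsE deltaE} => //; rewrite mulr0 ltxx.
split=> // near_eps; apply/eqO_exP.
(* The factor of [1 / n] in the pointwise bound. *)
exists ((2%:R * c ^+ 2 + 3%:R) / c ^+ 4).
  by rewrite divr_gt0 ?exprn_gt0//; lra.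
near=> n.
have [eps_gt0 epsE] : 0 < eps0 n /\ expR (eps0 n) = c ^+ 2 * n%:R.
  by near: n.
rewrite ger0_norm ?le_cam_distance_ge0// ger0_norm ?invr_ge0//.
by rewrite -mulrA -invfM; have [] := bound n eps_gt0 epsE.
Unshelve. all: by end_near. Qed.
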